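(* Let $\bar x\in\mathbb{R}^n$, let $\Phi\in\mathbb{R}^{n\times r}$ have orthonormal columns ($\Phi^\top\Phi=I_r$), let $S\in\mathbb{R}^{q\times n}$ be a sampling matrix with $\operatorname{rank}(S\Phi)=r$, and consider $\mathcal F_{\mathrm{POD}}(a)=\bar x+\Phi a$ for $a\in\mathbb{R}^r$. Let $x\in\mathbb{R}^n$, $\eta\in\mathbb{R}^q$ and $y=Sx+\eta$. Let $\widehat a\in\mathbb{R}^r$ satisfy the normal equations $$\Phi^\top S^\top\bigl(y-S(\bar x+\Phi\widehat a)\bigr)=0,$$ and set $\widehat x:=\bar x+\Phi\widehat a$, $u_\Phi:=(I-\Phi\Phi^\top)(x-\bar x)$. Then $$x-\widehat x=u_\Phi-\Phi(S\Phi)^\dagger(Su_\Phi+\eta),$$ $$\lVert x-\widehat x\rVert_2^2=\lVert u_\Phi\rVert_2^2+\lVert(S\Phi)^\dagger(Su_\Phi+\eta)\rVert_2^2,$$ $$\lVert x-\widehat x\rVert_2\le\frac{\lVert u_\Phi\rVert_2+\lVert\eta\rVert_2}{\sigma_{\min}(S\Phi)} .$$ Moreover $D_a^2\mathcal F_{\mathrm{POD}}\equiv0$.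
   Context: A sampling matrix $S\in\mathbb{R}^{q\times n}$ extracts the entries of a vector with distinct indices $i_1,\dots,i_q\in\{1,\dots,n\}$: its rows are the standard basis row vectors $e_{i_1}^\top,\dots,e_{i_q}^\top$, so $SS^\top=I_q$. The vector $\eta$ is measurement noise. $\lVert\cdot\rVert_2$ is the Euclidean norm; $A^\dagger$ is the Moore--Penrose inverse; $\sigma_{\min}(A)$ is the smallest singular value of a matrix $A$ with at least as many rows as columns. Here $r\ge1$. *)

(* Defs.v *)
From HB Require Import structures.
From mathcomp Require Export all_boot all_order all_algebra.
From mathcomp Require Export boolp classical_sets reals.
From mathcomp Require Export topology normedtype derive.
Set Implicit Arguments.
Unset Strict Implicit.
Unset Printing Implicit Defensive.
Export Order.TTheory GRing.Theory Num.Theory.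
Export numFieldNormedType.Exports.
Local Open Scope classical_set_scope.
Local Open Scope ring_scope.

(* The library norm [`|v|] on matrices is the sup norm, so the Euclidean norm
   is defined separately. *)
Definition norm2 (R : realType) (n : nat) (v : 'cV[R]_n) : R :=
  Num.sqrt (\sum_(i < n) v i 0 ^+ 2).

Definition is_sampling (R : realType) (q n : nat) (S : 'M[R]_(q, n)) : Prop :=
  exists2 f : 'I_q -> 'I_n,
    injective f & forall k, row k S = delta_mx 0 (f k).

Definition penrose (R : realType) (m n : nat)
    (A : 'M[R]_(m, n)) (B : 'M[R]_(n, m)) : Prop :=
  [/\ A *m B *m A = A, B *m A *m B = B,
      (A *m B)^T = A *m B & (B *m A)^T = B *m A].

Lemma penrose_unique (R : realType) (m n : nat) (A : 'M[R]_(m, n)) B C :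
  penrose A B -> penrose A C -> B = C.
Proof.
move=> [b1 b2 b3 b4] [c1 c2 c3 c4].
have AB : A *m B = A *m C.
  have e : A *m C *m (A *m B) = A *m B by rewrite mulmxA c1.
  by rewrite -b3 -{1}e trmx_mul b3 c3 mulmxA b1.
have BA : B *m A = C *m A.
  have e : B *m A *m (C *m A) = B *m A by rewrite -mulmxA (mulmxA A) c1.
  by rewrite -b4 -{1}e trmx_mul b4 c4 -mulmxA (mulmxA A) b1.
by rewrite -b2 -mulmxA AB mulmxA BA c2.
Qed.

Lemma gram_unitmx (R : realType) (m n : nat) (A : 'M[R]_(m, n)) :
  row_free A -> A *m A^T \in unitmx.
Proof.
move=> Afree; rewrite -row_free_unit -kermx_eq0; apply/rowV0P => v.
move=> /sub_kermxP vA; apply: (row_free_inj Afree); rewrite mul0mx.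
have : (v *m A) *m (v *m A)^T = 0 by rewrite trmx_mul mulmxA -(mulmxA v) vA mul0mx.
move/matrixP/(_ 0 0); rewrite mxE [RHS]mxE => /eqP.
rewrite psumr_eq0 => [/allP w0|k _]; last by rewrite [X in _ * X]mxE -expr2 sqr_ge0.
apply/rowP => k; have := w0 k (mem_index_enum k).
by rewrite /= [X in _ * X]mxE -expr2 sqrf_eq0 => /eqP ->; rewrite mxE.
Qed.

Lemma penrose_exists (R : realType) (m n : nat) (A : 'M[R]_(m, n)) :
  exists B, penrose A B.
Proof.
have [k [L [T [Lfree Tfree <-]]]] : exists k (L : 'M[R]_(m, k)) (T : 'M[R]_(k, n)),
    [/\ row_free L^T, row_free T & L *m T = A].
  exists (\rank A), (col_base A), (row_base A); split; last exact: mulmx_base.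
    by rewrite /row_free mxrank_tr; have := col_base_full A.
  exact: row_base_free.
have G1 : L^T *m L \in unitmx.
  by have := gram_unitmx Lfree; rewrite trmxK.
have G2 : T *m T^T \in unitmx by apply: gram_unitmx.
set H1 := invmx (L^T *m L); set H2 := invmx (T *m T^T).
have AB : L *m T *m (T^T *m H2 *m H1 *m L^T) = L *m H1 *m L^T.
  by rewrite !mulmxA -(mulmxA L) -(mulmxA L _ H2) mulmxV // mulmx1.
have BA : (T^T *m H2 *m H1 *m L^T) *m (L *m T) = T^T *m H2 *m T.
  by rewrite -!mulmxA (mulmxA L^T) (mulmxA H1) mulVmx // mul1mx.
have tH1 : H1^T = H1 by rewrite /H1 trmx_inv trmx_mul trmxK.
have tH2 : H2^T = H2 by rewrite /H2 trmx_inv trmx_mul trmxK.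
exists (T^T *m H2 *m H1 *m L^T); split.
- by rewrite AB -!mulmxA (mulmxA L^T) (mulmxA H1) mulVmx // mul1mx.
- rewrite BA -!mulmxA (mulmxA T) (mulmxA (T *m T^T)) mulmxV // mul1mx.
  by rewrite !mulmxA.
- by rewrite AB !trmx_mul trmxK tH1 mulmxA.
- by rewrite BA !trmx_mul trmxK tH2 mulmxA.
Qed.

(* The unique matrix satisfying the Penrose conditions. *)
Definition mppinv (R : realType) (m n : nat) (A : 'M[R]_(m, n)) : 'M[R]_(n, m) :=
  xget 0 [set B | penrose A B].

Lemma mppinvP (R : realType) (m n : nat) (A : 'M[R]_(m, n)) :
  penrose A (mppinv A).
Proof. exact: xgetPex (penrose_exists A). Qed.

(* For a matrix with at least as many rows as columns, the singular values are
   the square roots of the eigenvalues of [A^T *m A]. *)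
Definition singular_value (R : realType) (m n : nat) (A : 'M[R]_(m, n)) (s : R) :
  Prop := 0 <= s /\ eigenvalue (A^T *m A) (s ^+ 2).

(* The set of singular values is finite, and nonempty when [0 < n], so that
   this infimum is a minimum. *)
Definition sigma_min (R : realType) (m n : nat) (A : 'M[R]_(m, n)) : R :=
  inf [set s | singular_value A s].

Definition pod (R : realType) (n r : nat) (xbar : 'cV[R]_n) (Phi : 'M[R]_(n, r))
    (a : 'cV[R]_r) : 'cV[R]_n := xbar + Phi *m a.

(* Matrix of the Frechet differential of [F] at [a], acting on columns: the
   library's [jacobian] is for functions on row vectors. *)
Definition Dmx (R : realType) (r n : nat) (F : 'cV[R]_r -> 'cV[R]_n)
    (a : 'cV[R]_r) : 'M[R]_(n, r) :=
  \matrix_(i < n, j < r) ('d F a (delta_mx j 0 : 'cV[R]_r)) i 0.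

Definition twice_differentiable (R : realType) (r n : nat)
    (F : 'cV[R]_r -> 'cV[R]_n) : Prop :=
  forall a, differentiable F a /\ differentiable (Dmx F) a.

(* The second Frechet derivative at [a], as a bilinear map applied to [h] and
   [k]: the space of linear maps from [R^r] to [R^n] is represented by
   n x r matrices. *)
Definition D2 (R : realType) (r n : nat) (F : 'cV[R]_r -> 'cV[R]_n)
    (a h k : 'cV[R]_r) : 'cV[R]_n := ('d (Dmx F) a h) *m k.

(* Main.v *)
(* Put [A = S *m Phi], [B = mppinv A] and [b = Phi^T *m (x - xbar)]. Full column
   rank makes [A^T *m A] invertible, so the normal equations say
   [ahat - b = B *m (S *m u + eta)]; the first two claims follow since [Phi] is
   an isometry whose range is orthogonal to [u].
   For the bound, [sigma_min A ^+ 2] is the minimum of the Rayleigh quotient of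
   [A^T *m A], hence the noise term is at most [norm2 eta / sigma_min A]. For
   [eta = 0], let [v = B *m (S *m u)] and [A^T *m A *m w = v]. As [u] is
   orthogonal to the range of [Phi], [dot v v] equals
   [dot (S^T *m A *m w - Phi *m v) u], and the first factor has squared norm
   [dot w v - dot v v <= (sigma_min A ^- 2 - 1) * dot v v], so Cauchy-Schwarz
   bounds [dot u u + dot v v] by [dot u u / sigma_min A ^+ 2]. *)
Require Import Defs.
From mathcomp Require Import functions ring lra.
Set Implicit Arguments.
Unset Strict Implicit.
Unset Printing Implicit Defensive.
Local Open Scope ring_scope.

(** * The Euclidean inner product *)

Definition dot (R : realType) (n : nat) (u v : 'cV[R]_n) : R := (u^T *m v) 0 0.

Section Dot.
Variable R : realType.
Implicit Types m n : nat.

Lemma dotC n (u v : 'cV[R]_n) : dot u v = dot v u.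
Proof. by rewrite /dot -[u^T *m v]trmxK trmx_mul trmxK [LHS]mxE. Qed.

Lemma dotDr n (u v w : 'cV[R]_n) : dot u (v + w) = dot u v + dot u w.
Proof. by rewrite /dot mulmxDr mxE. Qed.

Lemma dotZr n a (u v : 'cV[R]_n) : dot u (a *: v) = a * dot u v.
Proof. by rewrite /dot -scalemxAr mxE. Qed.

Lemma dotNr n (u v : 'cV[R]_n) : dot u (- v) = - dot u v.
Proof. by rewrite /dot mulmxN mxE. Qed.

Lemma dotDl n (u v w : 'cV[R]_n) : dot (v + w) u = dot v u + dot w u.
Proof. by rewrite dotC dotDr !(dotC u). Qed.

Lemma dotZl n a (u v : 'cV[R]_n) : dot (a *: v) u = a * dot v u.
Proof. by rewrite dotC dotZr (dotC u). Qed.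

Lemma dotNl n (u v : 'cV[R]_n) : dot (- v) u = - dot v u.
Proof. by rewrite dotC dotNr (dotC u). Qed.

Definition dotE := (dotDl, dotDr, dotNl, dotNr, dotZl, dotZr).

Lemma dot_mulmx m n (A : 'M[R]_(m, n)) u v : dot (A *m u) v = dot u (A^T *m v).
Proof. by rewrite /dot trmx_mul mulmxA. Qed.

Lemma dot_sum n (v : 'cV[R]_n) : dot v v = \sum_i v i 0 ^+ 2.
Proof. by rewrite /dot mxE; apply: eq_bigr => i _; rewrite mxE expr2. Qed.

Lemma dot_ge0 n (v : 'cV[R]_n) : 0 <= dot v v.
Proof. by rewrite dot_sum sumr_ge0// => i _; apply: sqr_ge0. Qed.

Lemma dot_eq0 n (v : 'cV[R]_n) : (dot v v == 0) = (v == 0).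
Proof.
apply/eqP/eqP => [/eqP|->]; last by rewrite /dot mulmx0 mxE.
rewrite dot_sum psumr_eq0 => [/allP w0|i _]; last exact: sqr_ge0.
apply/colP => i; have := w0 i (mem_index_enum i).
by rewrite /= sqrf_eq0 => /eqP ->; rewrite mxE.
Qed.

Lemma norm2_sqr n (v : 'cV[R]_n) : norm2 v ^+ 2 = dot v v.
Proof. by rewrite /norm2 -dot_sum sqr_sqrtr// dot_ge0. Qed.

Lemma norm2_ge0 n (v : 'cV[R]_n) : 0 <= norm2 v.
Proof. exact: sqrtr_ge0. Qed.

Lemma norm2_le n (v : 'cV[R]_n) a : 0 <= a -> dot v v <= a ^+ 2 -> norm2 v <= a.
Proof. by move=> a0 va; rewrite -(@ler_pXn2r _ 2) ?nnegrE ?norm2_ge0// norm2_sqr. Qed.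

(** * Positive semidefinite forms, Cauchy-Schwarz and the least eigenvalue *)

Definition psdmx n (H : 'M[R]_n) :=
  H^T = H /\ forall v : 'cV[R]_n, 0 <= dot v (H *m v).

Lemma psdmx_cauchy_schwarz n (H : 'M[R]_n) (u v : 'cV[R]_n) : psdmx H ->
  dot u (H *m v) ^+ 2 <= dot u (H *m u) * dot v (H *m v).
Proof.
move=> [symH posH].
have q s t : 0 <= s ^+ 2 * dot u (H *m u) + 2 * s * t * dot u (H *m v)
                  + t ^+ 2 * dot v (H *m v).
  have := posH (s *: u + t *: v).
  have vu : dot v (H *m u) = dot u (H *m v) by rewrite -{1}symH -dot_mulmx dotC.
  rewrite mulmxDr -!scalemxAr !dotE vu.
  by congr (_ <= _); ring.
have := posH u; have := posH v; move: q.
set a := dot u (H *m u); set b := dot u (H *m v); set c := dot v (H *m v).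
move=> q c0 a0.
have [c_eq0|c_neq0] := eqVneq c 0; last first.
  have c_gt0 : 0 < c by rewrite lt_neqAle eq_sym c_neq0.
  (* The minimiser of the quadratic form along [u], scaled by [c] to avoid division. *)
  have := q c (- b).
  rewrite (_ : _ + _ = c * (a * c - b ^+ 2)); last by ring.
  by rewrite pmulr_rge0// subr_ge0.
(* Here the form equals [- (a + 2) * b ^+ 2], which forces [b = 0]. *)
have := q b (- (a + 1)) ; rewrite c_eq0 => q1.
have b2 := sqr_ge0 b.
nra.
Qed.

Lemma psdmx1 n : psdmx (1%:M : 'M[R]_n).
Proof. by split=> [|v]; rewrite ?trmx1// mul1mx dot_ge0. Qed.

Lemma cauchy_schwarz n (u v : 'cV[R]_n) : dot u v ^+ 2 <= dot u u * dot v v.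
Proof. by have := psdmx_cauchy_schwarz u v (psdmx1 n); rewrite !mul1mx. Qed.

Lemma dot_le_norm2 n (u v : 'cV[R]_n) : dot u v <= norm2 u * norm2 v.
Proof.
apply: le_trans (ler_norm _) _.
rewrite -(@ler_pXn2r _ 2) ?nnegrE ?mulr_ge0 ?norm2_ge0//.
by rewrite real_normK ?num_real// exprMn !norm2_sqr cauchy_schwarz.
Qed.

Lemma norm2D n (u v : 'cV[R]_n) : norm2 (u + v) <= norm2 u + norm2 v.
Proof.
apply: norm2_le; first by rewrite addr_ge0 ?norm2_ge0.
rewrite !dotE (dotC v u) sqrrD !norm2_sqr.
have := dot_le_norm2 u v; lra.
Qed.

Lemma norm2N n (u : 'cV[R]_n) : norm2 (- u) = norm2 u.
Proof. by rewrite /norm2; congr Num.sqrt; apply: eq_bigr => i _; rewrite mxE sqrrN. Qed.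

(** Cauchy-Schwarz on each row: the squared Frobenius norm is a bound. Adding 1 keeps the constant
    invertible and at most its own square. *)
Lemma mulmx_bounded m n (A : 'M[R]_(m, n)) :
  exists2 C, 1 <= C & forall v, dot (A *m v) (A *m v) <= C * dot v v.
Proof.
exists (1 + \sum_i dot (row i A)^T (row i A)^T) => [|v].
  by rewrite lerDl sumr_ge0// => i _; apply: dot_ge0.
rewrite dot_sum mulrDl mul1r mulr_suml.
apply: le_trans (_ : \sum_i dot (row i A)^T (row i A)^T * dot v v <= _).
  apply: ler_sum => i _; suff -> : (A *m v) i 0 = dot (row i A)^T v.
    exact: cauchy_schwarz.
  by rewrite /dot trmxK -row_mul [RHS]mxE.
by rewrite lerDr dot_ge0.
Qed.

(** With [w = H *m v], Cauchy-Schwarz for the form of [H] gives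
    [dot w w ^+ 2 <= dot w (H *m w) * dot v w], hence [dot w w <= C * dot v w]; the bound [D] on the
    inverse gives [dot v v <= D * dot w w]. *)
Lemma psdmx_unit_coercive n (H : 'M[R]_n) : psdmx H -> H \in unitmx ->
  exists2 c, 0 < c & forall v, c * dot v v <= dot v (H *m v).
Proof.
move=> psdH uH.
have [C C1 boundH] := mulmx_bounded H.
have [D D1 boundV] := mulmx_bounded (invmx H).
exists (D * C)^-1 => [|v]; first by rewrite invr_gt0; nra.
rewrite ler_pdivrMl; last by nra.
have := boundV (H *m v); rewrite mulKmx// => /le_trans; apply.
rewrite -mulrA ler_pM2l; last by lra.
set w := H *m v; set W := dot w w.
have W0 : 0 <= W := dot_ge0 w.
(* [C] bounds squared norms, so Cauchy-Schwarz yields a factor [Num.sqrt C]; [1 <= C] relaxes it to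
   [C]. *)
have HwW : dot w (H *m w) <= C * W.
  rewrite -(@ler_pXn2r _ 2) ?nnegrE ?psdH.2 ?mulr_ge0//; last by lra.
  apply: le_trans (cauchy_schwarz _ _) _.
  apply: le_trans (ler_wpM2l W0 (boundH w)) _; rewrite -/W.
  rewrite (_ : W * _ = W ^+ 2 * C) ?exprMn; last by ring.
  by rewrite mulrC ler_wpM2r ?sqr_ge0// ler_eXnr.
have := psdmx_cauchy_schwarz w v psdH.
rewrite -/w -/W => cs.
have e0 : 0 <= dot v w := psdH.2 v.
have [W_eq0|W_neq0] := eqVneq W 0; first by rewrite W_eq0; nra.
have W_gt0 : 0 < W by rewrite lt_neqAle eq_sym W_neq0.
rewrite -(ler_pM2l W_gt0); nra.
Qed.

(* The infimum [mu] of the Rayleigh quotient is an eigenvalue: otherwise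
   [G - mu%:M] would be invertible, hence coercive, and [mu] could be
   increased. *)
Lemma psdmx_min_eigenvalue n (G : 'M[R]_n) : (0 < n)%N -> psdmx G ->
  exists2 mu, eigenvalue G mu & forall v, mu * dot v v <= dot v (G *m v).
Proof.
move=> n_gt0 psdG.
pose E := [set dot v (G *m v) / dot v v | v in [set v : 'cV[R]_n | v != 0]]%classic.
have dot_gt0 (v : 'cV[R]_n) : v != 0 -> 0 < dot v v.
  by move=> v0; rewrite lt_neqAle eq_sym dot_eq0 v0 dot_ge0.
have E0 : (E !=set0)%classic.
  pose e := const_mx 1 : 'cV[R]_n; exists (dot e (G *m e) / dot e e), e => //=.
  by apply/eqP => /colP/(_ (Ordinal n_gt0)); rewrite !mxE => /eqP; rewrite oner_eq0.
have lbE : has_lbound E.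
  by exists 0 => _ [v /= v0 <-]; rewrite divr_ge0 ?psdG.2 ?dot_ge0.
pose mu := inf E.
have muP v : mu * dot v v <= dot v (G *m v).
  have [->|v0] := eqVneq v 0; first by rewrite /dot !mulmx0 mxE mulr0.
  by rewrite -ler_pdivlMr ?dot_gt0//; apply: ge_inf => //; exists v.
exists mu => //; rewrite /eigenvalue /eigenspace kermx_eq0 row_free_unit.
apply/negP => uH.
have HE v : dot v ((G - mu%:M) *m v) = dot v (G *m v) - mu * dot v v.
  by rewrite mulmxBl mul_scalar_mx !dotE.
have psdH : psdmx (G - mu%:M).
  split=> [|v]; last by rewrite HE subr_ge0.
  by rewrite linearB /= psdG.1 tr_scalar_mx.
have [c c0 cP] := psdmx_unit_coercive psdH uH.
suff : mu + c <= mu by lra.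
apply: lb_le_inf => // _ [v /= v0 <-].
rewrite ler_pdivlMr ?dot_gt0//.
by have := cP v; rewrite HE; lra.
Qed.

(** * Gram matrices, the smallest singular value and the pseudoinverse *)

Lemma psdmx_gram m n (A : 'M[R]_(m, n)) : psdmx (A^T *m A).
Proof.
split=> [|v]; first by rewrite trmx_mul trmxK.
by rewrite -mulmxA -dot_mulmx dot_ge0.
Qed.

Lemma gram_unit_full_rank m n (A : 'M[R]_(m, n)) :
  \rank A = n -> A^T *m A \in unitmx.
Proof.
move=> rkA; rewrite -[X in _ *m X]trmxK; apply: gram_unitmx.
by rewrite /row_free mxrank_tr rkA.
Qed.

(** The root of the least eigenvalue [mu] of the Gram matrix is a singular value and a lower bound
    of all of them, so it is the infimum. Full column rank excludes the eigenvalue 0. *)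
Lemma sigma_minP m n (A : 'M[R]_(m, n)) : (0 < n)%N -> \rank A = n ->
  0 < sigma_min A /\
  forall v, sigma_min A ^+ 2 * dot v v <= dot (A *m v) (A *m v).
Proof.
move=> n_gt0 rkA.
have [mu eig muP] := psdmx_min_eigenvalue n_gt0 (psdmx_gram A).
have gramE v : dot v (A^T *m A *m v) = dot (A *m v) (A *m v).
  by rewrite -mulmxA dot_mulmx.
have eigP a : eigenvalue (A^T *m A) a -> 0 <= a /\ (a != 0 /\ mu <= a).
  move=> /eigenvalueP[v va v0].
  (* Eigenvectors are row vectors here; symmetry of the Gram matrix lets them be transposed. *)
  have vT : A^T *m A *m v^T = a *: v^T.
    by have := congr1 trmx va; rewrite linearZ /= !trmx_mul trmxK.
  have d0 : 0 < dot v^T v^T.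
    by rewrite lt_neqAle dot_ge0 eq_sym dot_eq0 trmx_eq0 v0.
  have a0 : 0 <= a * dot v^T v^T by rewrite -dotZr -vT gramE dot_ge0.
  split; first by rewrite -(pmulr_lge0 _ d0).
  split; last by rewrite -(ler_pM2r d0) -(dotZr a) -vT; exact: muP.
  apply/eqP => a_eq0; move/eqP: v0; apply.
  by rewrite -(mulmxK (gram_unit_full_rank rkA) v) va a_eq0 scale0r mul0mx.
have [mu0 [mu_neq0 _]] := eigP _ eig.
have mu_gt0 : 0 < mu by rewrite lt_neqAle eq_sym mu_neq0.
have sv : singular_value A (Num.sqrt mu).
  by split; rewrite ?sqrtr_ge0// sqr_sqrtr.
have s_ge : Num.sqrt mu <= sigma_min A.
  apply: lb_le_inf; first by exists (Num.sqrt mu).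
  move=> s [s0 /eigP[_ [_ mus]]].
  by rewrite -(ger0_norm s0) -sqrtr_sqr ler_sqrt// sqr_ge0.
have s_le : sigma_min A <= Num.sqrt mu.
  by apply: ge_inf => //; exists 0 => s [].
have s_gt0 : 0 < sigma_min A by apply: lt_le_trans s_ge; rewrite sqrtr_gt0.
split=> // v; rewrite -gramE; apply: le_trans (muP v).
rewrite ler_wpM2r ?dot_ge0// -(sqr_sqrtr mu0).
by rewrite ler_pXn2r// ?nnegrE ?sqrtr_ge0// ltW.
Qed.

(** This says that [mppinv A *m w] solves the normal equations with data [w]. *)
Lemma trmx_mppinv m n (A : 'M[R]_(m, n)) : A^T *m A *m mppinv A = A^T.
Proof.
by have [ABA _ symAB _] := mppinvP A; rewrite -mulmxA -symAB -trmx_mul ABA.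
Qed.

(** [A *m mppinv A] is an orthogonal projection, so it does not increase norms, while [A] stretches
    by at least [sigma_min A]. *)
Lemma norm2_mppinv m n (A : 'M[R]_(m, n)) (w : 'cV[R]_m) :
  (0 < n)%N -> \rank A = n ->
  norm2 (mppinv A *m w) <= norm2 w / sigma_min A.
Proof.
move=> n_gt0 rkA; have [s_gt0 sP] := sigma_minP n_gt0 rkA.
apply: norm2_le; first by rewrite divr_ge0 ?norm2_ge0 ?ltW.
rewrite expr_div_n ler_pdivlMr ?exprn_gt0// mulrC.
apply: le_trans (sP _) _; rewrite norm2_sqr mulmxA.
have [ABA _ symAB _] := mppinvP A; set P := A *m mppinv A.
have PP : dot (P *m w) (P *m w) = dot w (P *m w).
  by rewrite dot_mulmx symAB mulmxA mulmxA ABA.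
have := dot_ge0 (w - P *m w); rewrite !dotE PP (dotC (P *m w)).
lra.
Qed.

(** * Sampling matrices and oblique projections *)

Lemma sampling_mul_tr q n (S : 'M[R]_(q, n)) : is_sampling S -> S *m S^T = 1%:M.
Proof.
move=> [f f_inj Sf]; apply/matrixP => k l.
have SE i j : S i j = (j == f i)%:R.
  by have /rowP/(_ j) := Sf i; rewrite !mxE eqxx.
rewrite !mxE (bigD1 (f k))//= big1 ?addr0 => [|j jk].
  by rewrite mxE !SE eqxx mul1r (inj_eq f_inj).
by rewrite SE (negbTE jk) mul0r.
Qed.

(** The difference of the two sides is the squared norm of [z - S^T *m (S *m z)]. *)
Lemma dot_coisometry_le q n (S : 'M[R]_(q, n)) (z : 'cV[R]_n) :
  S *m S^T = 1%:M -> dot (S *m z) (S *m z) <= dot z z.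
Proof.
move=> SS; have := dot_ge0 (z - S^T *m (S *m z)).
rewrite !dotE !(dotC (S^T *m _)) -!dot_mulmx !(mulmxA S) SS mul1mx.
lra.
Qed.

(* [Phi *m mppinv (S *m Phi) *m S] is an oblique projection onto the range of
   [Phi]. Complementary oblique projections have the same norm, which is why the
   factor is [1 / sigma_min] and not [1 + 1 / sigma_min]. *)
Lemma norm2_oblique n r q (Phi : 'M[R]_(n, r)) (S : 'M[R]_(q, n)) (u : 'cV[R]_n) :
  (0 < r)%N -> Phi^T *m Phi = 1%:M -> S *m S^T = 1%:M ->
  \rank (S *m Phi) = r -> Phi^T *m u = 0 ->
  norm2 (u - Phi *m (mppinv (S *m Phi) *m (S *m u))) <=
    norm2 u / sigma_min (S *m Phi).
Proof.
move=> r_gt0 PhiPhi SS rkA Phiu; set A := S *m Phi.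
have [s_gt0 sP] := sigma_minP r_gt0 rkA; rewrite -/A in s_gt0 sP.
set s := sigma_min A in s_gt0 sP *.
set v := mppinv A *m _.
have uA := gram_unit_full_rank rkA; rewrite -/A in uA.
have Gv : A^T *m A *m v = Phi^T *m (S^T *m (S *m u)).
  by rewrite /v mulmxA trmx_mppinv /A trmx_mul -!mulmxA.
have dPhi a b : dot (Phi *m a) (Phi *m b) = dot a b.
  by rewrite dot_mulmx mulmxA PhiPhi mul1mx.
have Phi_u b : dot (Phi *m b) u = 0.
  by rewrite dot_mulmx Phiu /dot mulmx0 mxE.
have s_le1 : s ^+ 2 <= 1.
  pose e := const_mx 1 : 'cV[R]_r.
  have e_gt0 : 0 < dot e e.
    rewrite lt_neqAle dot_ge0 eq_sym dot_eq0 andbT.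
    by apply/eqP => /colP/(_ (Ordinal r_gt0)); rewrite !mxE => /eqP; rewrite oner_eq0.
  rewrite -(ler_pM2r e_gt0) mul1r; apply: le_trans (sP e) _.
  by rewrite -mulmxA -[leRHS]dPhi dot_coisometry_le.
have [w Gw] : exists w, A^T *m A *m w = v.
  by exists (invmx (A^T *m A) *m v); rewrite mulKVmx.
pose z := S^T *m (A *m w).
have wv : dot w v = dot (A *m w) (A *m w) by rewrite -Gw -mulmxA dot_mulmx.
have zz : dot z z = dot w v.
  by rewrite wv /z dot_mulmx trmxK (mulmxA S S^T) SS mul1mx.
have zPhi : dot z (Phi *m v) = dot v v.
  rewrite dotC dot_mulmx; congr dot.
  by rewrite -[RHS]Gw /z /A trmx_mul !mulmxA.
(* Subtracting [Phi *m v] leaves the product with [u] unchanged but lowers the squared norm of the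
   first factor from [dot w v] to [dot w v - dot v v]. *)
have vv : dot v v = dot (z - Phi *m v) u.
  rewrite dotDl dotNl Phi_u subr0.
  have -> : dot z u = dot w (A^T *m A *m v).
    by rewrite Gv /z /A dot_mulmx trmxK -(mulmxA S) !dot_mulmx.
  by rewrite -(psdmx_gram A).1 -dot_mulmx Gw.
have := cauchy_schwarz (z - Phi *m v) u.
have := dot_ge0 (z - Phi *m v).
rewrite -vv !dotE dPhi zz (dotC (Phi *m v)) zPhi.
have cs := cauchy_schwarz w v.
have := sP w; rewrite -wv.
move: cs; set V := dot v v; set U := dot u u; set W := dot w w; set t := dot w v.
move=> cs sW N0 csN.
have V0 : 0 <= V := dot_ge0 v.
have U0 : 0 <= U := dot_ge0 u.
have s2_gt0 : 0 < s ^+ 2 by rewrite exprn_gt0.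
have t_ge0 : 0 <= t by rewrite /t wv dot_ge0.
(* From [t ^+ 2 <= W * V] and [s ^+ 2 * W <= t], cancelling one factor [t]. *)
have st : s ^+ 2 * t <= V.
  have [->|t_neq0] := eqVneq t 0; first by rewrite mulr0.
  have t_gt0 : 0 < t by rewrite lt_neqAle eq_sym t_neq0.
  rewrite -(ler_pM2r t_gt0); nra.
apply: norm2_le; first by rewrite divr_ge0 ?norm2_ge0 ?ltW.
rewrite expr_div_n ler_pdivlMr ?exprn_gt0// norm2_sqr.
rewrite !dotE dPhi (dotC u) Phi_u -/V -/U.
(* For [V = 0] the goal follows from [s_le1]. Otherwise [V ^+ 2 <= (t - V) * U] and [st] give the
   goal multiplied by [V]. *)
have [V_eq0|V_neq0] := eqVneq V 0; first by rewrite V_eq0; nra.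
have V_gt0 : 0 < V by rewrite lt_neqAle eq_sym V_neq0.
rewrite -(ler_pM2r V_gt0); nra.
Qed.

End Dot.

(** * Derivatives of the affine map [pod], and the theorem *)

Lemma mulmx_continuous (R : realType) m n (A : 'M[R]_(m, n)) :
  continuous (fun v : 'cV[R]_n => A *m v).
Proof.
move=> v; apply: differentiable_continuous.
(* Expanding along the columns of [A] reduces differentiability to that of the coordinates. *)
pose f (j : 'I_n) : 'cV[R]_n -> 'cV[R]_m := fun w => w j 0 *: col j A.
rewrite (_ : (fun _ => _) = \sum_(j < n) f j).
  apply: differentiable_sum => j.
  exact/differentiableZl/differentiable_coord.
apply/funext => w; rewrite fct_sumE; apply/colP => i.
by rewrite !mxE summxE; apply: eq_bigr => j _; rewrite !mxE mulrC.
Qed.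

Lemma is_diff_pod (R : realType) n r (xbar : 'cV[R]_n) (Phi : 'M[R]_(n, r)) a :
  is_diff a (pod xbar Phi) (fun h => Phi *m h).
Proof.
pose L : {linear 'cV[R]_r -> 'cV[R]_n} := mulmx Phi.
have Lc : continuous L by exact: mulmx_continuous.
have dL : is_diff a L L.
  by apply: DiffDef; [exact: linear_differentiable | exact: diff_lin].
have -> : pod xbar Phi = cst xbar + (L : 'cV[R]_r -> 'cV[R]_n) by exact/funext.
by apply: is_diff_eq (is_diffD (is_diff_cst _ _) dL) _; rewrite add0r.
Qed.

Lemma Dmx_pod (R : realType) n r (xbar : 'cV[R]_n) (Phi : 'M[R]_(n, r)) :
  Dmx (pod xbar Phi) = cst Phi.
Proof.
apply/funext => a; apply/matrixP => i j; have d := is_diff_pod xbar Phi a.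
by rewrite !mxE diff_val -colE mxE.
Qed.

Theorem proposition4 (R : realType) (n r q : nat) (hr : (1 <= r)%N)
  (xbar : 'cV[R]_n) (Phi : 'M[R]_(n, r)) (hPhi : Phi^T *m Phi = 1%:M)
  (S : 'M[R]_(q, n)) (hS : is_sampling S) (hrank : \rank (S *m Phi) = r)
  (x : 'cV[R]_n) (eta y : 'cV[R]_q) (hy : y = S *m x + eta)
  (ahat : 'cV[R]_r)
  (hahat : Phi^T *m S^T *m (y - S *m (xbar + Phi *m ahat)) = 0) :
  let xhat := pod xbar Phi ahat in
  let u := (1%:M - Phi *m Phi^T) *m (x - xbar) in
  [/\ x - xhat = u - Phi *m mppinv (S *m Phi) *m (S *m u + eta),
      norm2 (x - xhat) ^+ 2 =
        norm2 u ^+ 2 + norm2 (mppinv (S *m Phi) *m (S *m u + eta)) ^+ 2,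
      norm2 (x - xhat) <= (norm2 u + norm2 eta) / sigma_min (S *m Phi) &
      twice_differentiable (pod xbar Phi) /\
        forall a h k : 'cV[R]_r, D2 (pod xbar Phi) a h k = 0].
Proof.
move=> xhat u; set A := S *m Phi in hrank *; set B := mppinv A.
pose b := Phi^T *m (x - xbar).
have xE : x = xbar + Phi *m b + u.
  rewrite /u mulmxBl mul1mx -mulmxA -/b.
  by apply/colP => i; rewrite !mxE; ring.
have Phi_u : Phi^T *m u = 0.
  by rewrite /u mulmxBl mul1mx mulmxBr !mulmxA hPhi mul1mx subrr.
have ab : ahat - b = B *m (S *m u + eta).
  have yE : y - S *m (xbar + Phi *m ahat) = S *m u + eta - A *m (ahat - b).
    rewrite hy {1}xE !mulmxDr !mulmxN /A !mulmxA.
    apply/colP => i; rewrite !mxE; ring.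
  have /eqP := hahat; rewrite yE -trmx_mul -/A mulmxBr subr_eq0 => /eqP e.
  (* Both sides agree once multiplied by the invertible [A^T *m A]: one by the normal equations, the
     other by [trmx_mppinv]. *)
  apply: (can_inj (mulKmx (gram_unit_full_rank hrank))).
  by rewrite -[LHS]mulmxA -e (mulmxA _ B) trmx_mppinv.
have err : x - xhat = u - Phi *m (B *m (S *m u + eta)).
  rewrite -ab /xhat /pod {1}xE mulmxBr.
  apply/colP => i; rewrite !mxE; ring.
have Phi_iso c : dot (Phi *m c) (Phi *m c) = dot c c.
  by rewrite dot_mulmx mulmxA hPhi mul1mx.
have Phi_orth c : dot (Phi *m c) u = 0.
  by rewrite dot_mulmx Phi_u /dot mulmx0 mxE.
split.
- by rewrite err mulmxA.
- by rewrite err !norm2_sqr !dotE Phi_iso (dotC u) Phi_orth; ring.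
(* Only the noise is split off: [u] stays with its oblique projection, so that [norm2_oblique]
   applies. *)
- have -> : x - xhat = (u - Phi *m (B *m (S *m u))) + - (Phi *m (B *m eta)).
    by rewrite err !mulmxDr opprD addrA.
  apply: le_trans (norm2D _ _) _; rewrite norm2N mulrDl lerD//.
    by rewrite norm2_oblique// sampling_mul_tr.
  have -> : norm2 (Phi *m (B *m eta)) = norm2 (B *m eta).
    by rewrite /norm2 -!dot_sum Phi_iso.
  exact: norm2_mppinv.
- split=> [a|a h k].
    rewrite Dmx_pod; split; last exact: differentiable_cst.
    by have [] := is_diff_pod xbar Phi a.
  by rewrite /D2 Dmx_pod diff_cst mul0mx.
Qed.
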